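(* Let $D$ be a pre-divergence on a Polish space $\mathcal{X}$, $c$ a cost function, and $\mu\in\mathcal{P}(\mathcal{X})$ such that (1) $P\mapsto D(P\|\mu)$ is lower semicontinuous and has compact sublevel sets, and (2) $D(\mu_n\|\mu)\to0$ implies $\mu_n\to\mu$ weakly. For $r>0$ let $c_r=rc$. Then for every $\nu\in\mathcal{P}(\mathcal{X})$, \[\lim_{r\to0^+}r^{-1}D^{c_r}(\nu\|\mu)=C(\mu,\nu).\]
   Context: $\mathcal{P}(\mathcal{X})$ is the set of Borel probability measures on the Polish space $\mathcal{X}$ with the weak topology. A pre-divergence is $D:\mathcal{P}(\mathcal{X})\times\mathcal{P}(\mathcal{X})\to[0,\infty]$ with $D(\mu\|\mu)=0$ for all $\mu$. A cost function is a lower semicontinuous $c:\mathcal{X}\times\mathcal{X}\to[0,\infty]$, with OT cost $C(\mu,\nu)=\inf\{\int c\,d\pi:\pi_1=\mu,\pi_2=\nu\}$. For a cost function $c'$, $D^{c'}(\nu\|\mu)=\inf_{\eta\in\mathcal{P}(\mathcal{X})}\{D(\eta\|\mu)+C'(\eta,\nu)\}$ where $C'$ is the OT cost of $c'$. *)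

(* Defs.v *)
From HB Require Import structures.
From mathcomp Require Import all_boot all_order all_algebra.
From mathcomp Require Import all_classical all_reals all_analysis.

Set Implicit Arguments.
Unset Strict Implicit.
Unset Printing Implicit Defensive.

Import Order.TTheory GRing.Theory Num.Theory.
Import numFieldNormedType.Exports.
Local Open Scope classical_set_scope.
Local Open Scope ring_scope.

Definition borel (X : ptopologicalType) := g_sigma_algebraType (@open X).

Definition bcfun (X : topologicalType) (R : realType) :=
  {f : X -> R | continuous f /\ exists M : R, forall x, `|f x| <= M}.

Definition weak_map (X : ptopologicalType) (R : realType)
  (P : probability (borel X) R) : {ptws bcfun X R -> \bar R} :=
  fun f => (\int[P]_x ((proj1_sig f x)%:E))%E.

(* P(X) with the weak topology (topology of weak convergence of measures):
   the initial topology making every P |-> \int f dP (f bounded continuous)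
   continuous. *)
Definition Pweak (X : ptopologicalType) (R : realType) :=
  initial_topology (@weak_map X R).

Definition is_coupling (X : ptopologicalType) (R : realType)
  (mu nu : probability (borel X) R)
  (pi : probability (borel X * borel X)%type R) :=
  (forall A : set (borel X), measurable A -> pi (A `*` setT) = mu A) /\
  (forall A : set (borel X), measurable A -> pi (setT `*` A) = nu A).

Definition OTcost (X : ptopologicalType) (R : realType)
  (c : X * X -> \bar R) (mu nu : probability (borel X) R) : \bar R :=
  ereal_inf [set (\int[pi]_z c z)%E | pi in [set pi | is_coupling mu nu pi]].

Definition Dcost (X : ptopologicalType) (R : realType)
  (D : probability (borel X) R -> probability (borel X) R -> \bar R)
  (c' : X * X -> \bar R) (nu mu : probability (borel X) R) : \bar R :=
  ereal_inf [set (D eta mu + OTcost c' eta nu)%E | eta in [set: probability (borel X) R]].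

Definition pre_divergence (X : ptopologicalType) (R : realType)
  (D : probability (borel X) R -> probability (borel X) R -> \bar R) :=
  (forall P Q, (0 <= D P Q)%E) /\ (forall mu, D mu mu = 0%E).

Definition cost_function (X : topologicalType) (R : realType)
  (c : X * X -> \bar R) :=
  (forall z, (0 <= c z)%E) /\ lower_semicontinuous c.

(* Polish: completely metrizable (we take X with a complete metric inducing
   its topology), Hausdorff (so the pseudometric is a metric), separable. *)
Definition polish (R : realType) (X : completePseudoMetricType R) :=
  hausdorff_space X /\ exists S : set X, countable S /\ dense S.

(* Main.v *)
(* Taking eta = mu bounds r^-1 D^(r c)(nu || mu) by C(mu, nu).  If the liminf
   were smaller, there would be a < C(mu, nu) and near-minimizers eta_n with
   D(eta_n || mu) -> 0 and C(eta_n, nu) < a; then eta_n -> mu weakly, so it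
   suffices that C(., nu) is sequentially lower semicontinuous.

   Near-optimal couplings pi_n of eta_n and nu have a limit coupling of mu and
   nu, obtained here through a Loeb measure instead of Prokhorov's theorem:
   along a nonprincipal ultrafilter U on nat, internal sets
   {w | for U-almost all n, w n in A n} of sequences carry the content
   lim_U pi_n (A n), which is countably additive by saturation and extends to a
   probability P.  Because the marginals converge weakly, P-almost every
   sequence w converges along U, and the law of its limit is the coupling.  Its
   mass of an open set is at most the U-limit of the masses under pi_n, so
   writing the cost as a limit of sums e * \sum_j 1_{c > (j + 1) e} gives
   \int c dpi <= lim_U \int c dpi_n. *)
Require Import Defs.
From HB Require Import structures.
From mathcomp Require Import all_boot all_order all_algebra.
From mathcomp Require Import all_classical all_reals all_analysis.
From mathcomp Require Import measurable_realfun lra.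
Import Order.TTheory GRing.Theory Num.Theory.
Import numFieldNormedType.Exports.
Local Open Scope classical_set_scope.
Local Open Scope ring_scope.

Set Implicit Arguments.
Unset Strict Implicit.
Unset Printing Implicit Defensive.

(** * Internal sets and the Loeb measure *)

(** Containing [\oo] makes this ultrafilter nonprincipal: limits along [\oo] persist along it, and
    every tail of [nat] is large, as saturation requires. *)
Definition ultra_nat : set_system nat :=
  sval (cid (@ultraFilterLemma nat \oo _)).

#[global] Instance ultra_nat_ultra : UltraFilter ultra_nat.
Proof. by rewrite /ultra_nat; case: cid => U []. Qed.

Lemma ultra_natS : \oo `<=` ultra_nat.
Proof. by rewrite /ultra_nat; case: cid => U []. Qed.

Lemma cvg_ultra_nat (T : topologicalType) (u : nat -> T) (l : T) :
  u @ \oo --> l -> u @ ultra_nat --> l.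
Proof. by move=> ul; apply: cvg_trans ul => A; exact: ultra_natS. Qed.

Lemma ultra_nat_meets (A B : set nat) :
  ultra_nat A -> ultra_nat B -> exists n, A n /\ B n.
Proof. by move=> UA UB; exact: (filter_ex (filterI UA UB)). Qed.

Lemma ultra_nat_setU (A B : set nat) :
  ultra_nat (A `|` B) -> ultra_nat A \/ ultra_nat B.
Proof.
move=> UAB; have [|UcA] := in_ultra_setVsetC A ultra_nat_ultra; first by left.
by right; apply: filterS (filterI UAB UcA) => n [[]].
Qed.

Lemma ultra_nat_bigcup (A : nat -> set nat) m :
  ultra_nat (\bigcup_(i < m) A i) -> exists2 i, (i < m)%N & ultra_nat (A i).
Proof.
rewrite bigcup_mkord; elim: m => [|m IHm].
  by rewrite big_ord0 => /filter_ex[].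
rewrite big_ord_recr/= => /ultra_nat_setU[/IHm[i im Ai]|]; last by exists m.
by exists i => //; exact: ltnW.
Qed.

(** Compactness of [[a, b]] yields a cluster point, and a cluster point of an ultrafilter is a
    limit: otherwise the complement of some neighbourhood would be large and could not meet it. *)
Lemma is_cvg_ultra_nat (R : realType) (u : nat -> R) (a b : R) :
  (forall n, a <= u n <= b) -> cvg (u @ ultra_nat).
Proof.
move=> uab; have [] := @segment_compact R a b (u @ ultra_nat) _.
  by apply: (@filterE _ ultra_nat _ (u @^-1` `[a, b])) => n /=;
    rewrite in_itv/=.
move=> l [_ clul]; apply/cvg_ex; exists l => A lA.
have [//|UcA] := in_ultra_setVsetC (u @^-1` A) ultra_nat_ultra.
by have [x []] := clul (~` A) A UcA lA.
Qed.

Section internal_sets.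
Context d (Z : measurableType d).

(** Representatives of points of the ultrapower of [Z]. No quotient by equality along U is taken,
    since [internal] sets are invariant under it. *)
Definition ultraseq : Type := nat -> Z.
HB.instance Definition _ := Choice.copy ultraseq (nat -> Z).
HB.instance Definition _ := isPointed.Build ultraseq (fun=> point).

Definition internal (A : nat -> set Z) : set ultraseq :=
  [set w | \forall n \near ultra_nat, A n (w n)].

Definition internal_measurable : set (set ultraseq) :=
  [set internal A | A in [set A | forall n, measurable (A n)]].

(** If the inclusion fails for U-almost all [n], a sequence of points of [A n] outside [B n]
    separates the two internal sets. Hence an internal set determines its sections U-almost
    everywhere. *)
Lemma internalS (A B : nat -> set Z) : internal A `<=` internal B <->
  \forall n \near ultra_nat, A n `<=` B n.
Proof.
split=> [AB|AB w]; last by rewrite /internal/=; apply: filterS2 AB => n; exact.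
have [//|UcAB] := in_ultra_setVsetC [set n | A n `<=` B n] ultra_nat_ultra.
have /choice[w wP] : forall n, exists z, ~ A n `<=` B n -> A n z /\ ~ B n z.
  move=> n; have [AnBn|/existsNP[z /not_implyP[Az Bz]]]
    := pselect (A n `<=` B n).
    by exists point.
  by exists z.
have Aw : internal A w by apply: filterS UcAB => n /wP[].
by have [n [Bnw /wP[]]] := ultra_nat_meets (AB _ Aw) UcAB.
Qed.

Lemma internalC (A : nat -> set Z) : ~` internal A = internal (fun n => ~` A n).
Proof.
apply/seteqP; split=> w /=.
  by have [|] := in_ultra_setVsetC [set n | A n (w n)] ultra_nat_ultra.
by move=> cAw Aw; have [n []] := ultra_nat_meets Aw cAw.
Qed.

Lemma internalU (A B : nat -> set Z) :
  internal A `|` internal B = internal (fun n => A n `|` B n).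
Proof.
apply/seteqP; split=> w; first by case; apply: filterS => n; [left|right].
exact: ultra_nat_setU.
Qed.

Lemma internal0 : internal (fun=> set0) = set0.
Proof. by apply/seteqP; split=> // w /filter_ex[]. Qed.

Lemma internalT : internal (fun=> setT) = setT.
Proof. by apply/seteqP; split=> // w _; exact: filterT. Qed.

(* Diagonal argument: pick w n in A N n for the largest N <= n such that A N n
   is nonempty. *)
Lemma internal_saturation (A : nat -> nat -> set Z) :
  (forall N n, A N.+1 n `<=` A N n) ->
  (forall N, internal (A N) !=set0) -> \bigcap_N internal (A N) !=set0.
Proof.
move=> dA A0.
have dA' n N M : (N <= M)%N -> A M n `<=` A N n.
  by move=> /subnK <-; elim: (M - N)%N => // k IH z /dA; exact: IH.
have /choice[w wP] : forall n, exists z, forall N, (N <= n)%N -> A N n !=set0 ->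
    A N n z.
  move=> n; have [|] := pselect (exists N, (N <= n)%N /\ A N n !=set0);
    last first.
    move=> nN; exists point => N Nn AN.
    by exfalso; apply: nN; exists N.
  move=> exN; have exb : exists N, (N <= n)%N && `[< A N n !=set0 >].
    by case: exN => N [Nn AN]; exists N; rewrite Nn; apply/asboolP.
  have ub N : (N <= n)%N && `[< A N n !=set0 >] -> (N <= n)%N by case/andP.
  case: (ex_maxnP exb ub) => M /andP[Mn /asboolP[z AMz]] maxM.
  exists z => N Nn AN; apply: dA' AMz; apply: maxM.
  by rewrite Nn; apply/asboolP.
exists w => N _; have [v Av] := A0 N.
have NU : ultra_nat [set n | (N <= n)%N].
  by apply: ultra_natS; exact: nbhs_infty_ge.
apply: filterS2 Av NU => n Av Nn; apply: wP => //; by exists (v n).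
Qed.

Lemma internal_bigcup (B : nat -> nat -> set Z) N :
  internal (fun n => \bigcup_(i < N) B i n) = \bigcup_(i < N) internal (B i).
Proof.
apply/seteqP; split=> [w /ultra_nat_bigcup[i iN Bi]|w [i iN]];
  first by exists i.
by apply: filterS => n Bn; exists i.
Qed.

(** Without a finite subcover, the sets [C N] left uncovered by the first [N] pieces form a
    decreasing sequence with nonempty internal sets; saturation gives a point in all of them, which
    no piece covers. *)
Lemma internal_cover (A : nat -> set Z) (B : nat -> nat -> set Z) :
  internal A `<=` \bigcup_i internal (B i) ->
  exists N, internal A `<=` \bigcup_(i < N) internal (B i).
Proof.
move=> AB; apply: contrapT => /forallNP noN.
pose C N n := A n `&` ~` (\bigcup_(i < N) B i n).
have CE N w : internal A w -> ~ (\bigcup_(i < N) internal (B i)) w ->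
    internal (C N) w.
  move=> Aw; rewrite -internal_bigcup -[~ _]/((~` _) w) internalC.
  exact: filterI.
have [|N|w wC] := @internal_saturation C.
- move=> N n z [Az nB]; split=> // -[i iN Bi]; apply: nB; exists i => //=.
  exact: ltnW.
- by have /existsNP[w /not_implyP[Aw nBw]] := noN N; exists w; exact: CE.
have Aw : internal A w by apply: filterS (wC 0%N I) => n [].
have [i _ Bi] := AB _ Aw.
have [n [[_ nB] Bn]] := ultra_nat_meets (wC i.+1 I) Bi.
by apply: nB; exists i => /=.
Qed.

Lemma internal_measurable0 : internal_measurable set0.
Proof. by exists (fun=> set0) => //; exact: internal0. Qed.

Lemma internal_measurableU : setU_closed internal_measurable.
Proof.
move=> _ _ [A mA <-] [B mB <-]; exists (fun n => A n `|` B n).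
  by move=> n; exact: measurableU.
by rewrite internalU.
Qed.

Lemma internal_measurableC : setC_closed internal_measurable.
Proof.
move=> _ [A mA <-]; exists (fun n => ~` A n); last by rewrite internalC.
by move=> n; exact: measurableC.
Qed.

End internal_sets.

(** Opaque, so that the algebra on sequences has a display distinct from that of [Z]. *)
Definition internal_display : measure_display -> measure_display.
Proof. exact. Qed.

HB.instance Definition _ d (Z : measurableType d) :=
  isAlgebraOfSets.Build (internal_display d) (ultraseq Z)
    (@internal_measurable0 _ Z) (@internal_measurableU _ Z)
    (@internal_measurableC _ Z).

Section ultraproduct_content.
Context d (Z : measurableType d) (R : realType).
Variable pi_ : nat -> probability Z R.

Definition ultralim (A : nat -> set Z) : R :=
  lim (fine (pi_ n (A n)) @[n --> ultra_nat]).

Lemma cvg_ultralim (A : nat -> set Z) : (forall n, measurable (A n)) ->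
  fine (pi_ n (A n)) @[n --> ultra_nat] --> ultralim A.
Proof.
move=> mA; apply: (@is_cvg_ultra_nat _ _ 0 1) => n.
rewrite fine_ge0//= -lee_fin fineK ?probability_le1//.
exact: fin_num_measure.
Qed.

Lemma ultralim_near (A B : nat -> set Z) :
  (\forall n \near ultra_nat, A n = B n) -> ultralim A = ultralim B.
Proof.
move=> AB; rewrite /ultralim; congr (lim _); apply/seteqP; split=> S /=.
- by apply: filterS2 AB => n /= ->.
- by apply: filterS2 AB => n /= ->.
Qed.

(* On a set that is not of the form internal A the value is junk, but still
   nonnegative, as isContent requires. *)
Definition ultra_content (S : set (ultraseq Z)) : \bar R :=
  (ultralim (get [set A | (forall n, measurable (A n)) /\ internal A = S]))%:E.

(** The representative picked by [get] is immaterial: by [internalS] it agrees with [A] for U-almost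
    all [n]. *)
Lemma ultra_contentE (A : nat -> set Z) : (forall n, measurable (A n)) ->
  ultra_content (internal A) = (ultralim A)%:E.
Proof.
move=> mA; congr EFin; apply: ultralim_near.
have [_ /seteqP[BA AB]] := @getPex _
  [set B | (forall n, measurable (B n)) /\ internal B = internal A]
  (ex_intro _ A (conj mA erefl)).
move/internalS : BA; move/internalS : AB; apply: filterS2 => n AB BA.
exact/seteqP.
Qed.

Lemma ultra_content_ge0 S : (0 <= ultra_content S)%E.
Proof.
rewrite lee_fin /ultralim; set u := fun n => _.
have [cu|/dvgP ->//] := pselect (cvg (u @ ultra_nat)).
by apply: limr_ge => //; apply: filterE => n; exact: fine_ge0.
Qed.

Lemma ultra_content0 : ultra_content set0 = 0%E.
Proof.
rewrite -internal0 ultra_contentE//; congr EFin; rewrite /ultralim.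
by under eq_fun do rewrite measure0; exact: lim_cst.
Qed.

Lemma ultra_content_semi_additive :
  measure_function.semi_additive ultra_content.
Proof.
apply/(additive2P ultra_content0) => _ _ [A mA <-] [B mB <-] AB0.
rewrite internalU !ultra_contentE//; last by move=> n; exact: measurableU.
rewrite -EFinD; congr EFin; apply/cvg_lim => //.
(* Sections of disjoint internal sets are disjoint only for U-almost all [n], which is enough for an
   identity between limits along U. *)
have AB : \forall n \near ultra_nat, A n `&` B n = set0.
  have : internal A `<=` internal (fun n => ~` B n).
    by rewrite -internalC; exact/disjoints_subset.
  by move/internalS; apply: filterS => n; move/disjoints_subset.
have UAB := cvgD (cvg_ultralim mA) (cvg_ultralim mB).
apply: cvg_trans; last exact: UAB.
apply: near_eq_cvg; near=> n => /=.
rewrite measureU//; first by rewrite fineD// fin_num_measure.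
by near: n.
Unshelve. all: by end_near. Qed.

HB.instance Definition _ := isContent.Build _ (ultraseq Z) R ultra_content
  ultra_content_ge0 ultra_content_semi_additive.

(** By [internal_cover] a countable cover has a finite subcover, so finite subadditivity
    suffices. *)
Lemma ultra_content_sigma_subadditive :
  measurable_subset_sigma_subadditive ultra_content.
Proof.
move=> A B mB [A' mA' AE] AB.
have /choice[B' B'P] : forall i, exists X : nat -> set Z,
    (forall n, measurable (X n)) /\ internal X = B i.
  by move=> i; case: (mB i) => X; exists X.
have [|N AN] := @internal_cover _ Z A' B'.
  rewrite AE => w /AB[i _ Bi]; exists i => //.
  by rewrite (B'P i).2.
have mA : measurable A by exists A'.
apply: (@le_trans _ _ (\sum_(i < N) ultra_content (B i))%E).
  apply: (@content_subadditive _ _ _ ultra_content) => //.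
  rewrite -AE -bigcup_mkord => w /AN[i iN]; rewrite (B'P i).2.
  by exists i.
rewrite -(big_mkord predT (fun i => ultra_content (B i))).
exact: nneseries_lim_ge.
Qed.

HB.instance Definition _ :=
  @Content_SigmaSubAdditive_isMeasure.Build _ R (ultraseq Z) ultra_content
    ultra_content_sigma_subadditive.

End ultraproduct_content.

Definition internal_algebra d (Z : measurableType d) :=
  g_sigma_algebraType (@measurable _ (ultraseq Z)).

Lemma measurable_internal d (Z : measurableType d) (A : nat -> set Z) :
  (forall n, measurable (A n)) ->
  measurable (internal A : set (internal_algebra Z)).
Proof. by move=> mA; apply: sub_sigma_algebra; exists A. Qed.

(** This is the Loeb measure, obtained as the Caratheodory extension of the content to the
    sigma-algebra generated by the internal sets. *)
Lemma loeb_probability d (Z : measurableType d) (R : realType)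
    (pi_ : nat -> probability Z R) :
  exists P : probability (internal_algebra Z) R,
    forall A : nat -> set Z, (forall n, measurable (A n)) ->
      pi_ n (A n) @[n --> ultra_nat] --> P (internal A).
Proof.
pose m := measure_extension (ultra_content pi_).
have mE A : (forall n, measurable (A n)) ->
    m (internal A) = (ultralim pi_ A)%:E.
  move=> mA; rewrite /m /measure_extension measurable_mu_extE; last by exists A.
  exact: ultra_contentE.
have m1 : m setT = 1%E.
  rewrite -internalT mE//; congr EFin; apply/cvg_lim => //.
  by under eq_fun do rewrite probability_setT; exact: cvg_cst.
pose P : probability _ R := HB.pack m (Measure_isProbability.Build _ _ _ m m1).
exists P => A mA; rewrite (_ : P _ = (ultralim pi_ A)%:E); last exact: mE.
apply: (@cvg_EFin _ _ ultra_nat); last exact: cvg_ultralim.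
by apply: nearW => n; exact: fin_num_measure.
Qed.

(** * Weak convergence and open sets *)

(** Take the distance to the complement of [G]; it is infinite when [G] is the whole space, so
    [contract] makes it real-valued. *)
Lemma open_level_fun (R : realType) (X : pseudoMetricType R) (G : set X) :
  open G -> exists phi : X -> R,
    [/\ continuous phi, forall x, 0 <= phi x & G = [set x | 0 < phi x]].
Proof.
move=> oG; exists (fun x => contract (edist_inf (~` G) x)); split.
- move=> x; apply/cvgrPdist_lt => e e0.
  have /cvg_ballP/(_ e e0) := @edist_inf_continuous R X (~` G) x.
  exact.
- by move=> x; rewrite -(contract0 R) le_contract edist_inf_ge0.
apply/seteqP; split=> x /= => [Gx|].
  rewrite -(contract0 R) lt_contract lt_neqAle edist_inf_ge0 andbT eq_sym.
  apply/eqP => d0;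
    have /nbhs_ballP[e/= e0 eG] : nbhs x G by exact: open_nbhs_nbhs.
  have : (edist_inf (~` G) x < e%:E)%E by rewrite d0 lte_fin.
  by move/ereal_inf_lt => [_ [a nGa <-]] /edist_lt_ball /eG.
by apply: contraPP => nGx; rewrite edist_inf0// contract0 ltxx.
Qed.

Lemma measurable_open (X : ptopologicalType) (G : set X) :
  open G -> measurable (G : set (borel X)).
Proof. exact: sub_sigma_algebra. Qed.

(** Superlevel sets of the distance function, with truncated multiples of it as Urysohn functions.
    They make weak convergence, which tests continuous functions, speak about open sets. *)
Lemma open_exhaustion (R : realType) (X : pseudoMetricType R) (G : set X) :
  open G -> exists G_ : nat -> set X,
    [/\ forall k, open (G_ k), nondecreasing_seq G_, \bigcup_k G_ k = G &
        forall k, exists f : X -> R, [/\ continuous f,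
          forall x, 0 <= f x <= 1, forall x, G_ k x -> f x = 1 &
          forall x, ~ G x -> f x = 0]].
Proof.
move=> /open_level_fun[phi [cphi phi0 ->]].
exists (fun k => [set x | k.+1%:R^-1 < phi x]); split.
- move=> k; exact: (@open_comp _ _ phi [set t | k.+1%:R^-1 < t]).
- move=> m n mn; rewrite subsetEset => x /=; apply: le_lt_trans.
  by rewrite lef_pV2 ?posrE// ler_nat.
- apply/seteqP; split=> x /=.
    by move=> [k _ /=]; apply: lt_trans; rewrite invr_gt0.
  move=> px; exists (Num.truncn (phi x)^-1) => //=.
  rewrite invf_plt ?posrE//; exact: truncnS_gt.
move=> k; exists (fun x => Num.min (k.+1%:R * phi x) 1); split.
- move=> x; apply: (@continuous_min _ _ (fun x => k.+1%:R * phi x) (fun=> 1)).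
    by apply: cvgM; [exact: cvg_cst|exact: cphi].
  exact: cvg_cst.
- by move=> x; rewrite ge_min lexx orbT andbT le_min ler01 andbT mulr_ge0.
- move=> x /= kx; apply/min_idPr; rewrite -ler_pdivrMl// mulr1; exact: ltW.
- move=> x /negP; rewrite -leNgt => px; have -> : phi x = 0.
    by apply/eqP; rewrite eq_le px phi0.
  by rewrite mulr0; apply/min_idPl.
Qed.

Lemma closed_shrinking (R : realType) (X : pseudoMetricType R) (F : set X) :
  closed F -> exists W_ : nat -> set X,
    [/\ forall k, open (W_ k), nonincreasing_seq W_ & \bigcap_k W_ k = F].
Proof.
move=> /closed_openC/open_level_fun[phi [cphi phi0 FE]].
exists (fun k => [set x | phi x < k.+1%:R^-1]); split.
- move=> k; exact: (@open_comp _ _ phi [set t | t < k.+1%:R^-1]).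
- move=> m n mn; rewrite subsetEset => x /=; move/lt_le_trans; apply.
  by rewrite lef_pV2 ?posrE// ler_nat.
rewrite -[F]setCK FE; apply/seteqP; split=> x /=; last first.
  move=> /negP; rewrite -leNgt => px k _ /=; apply: le_lt_trans px _.
  by rewrite invr_gt0.
move=> Ox px; have := Ox (Num.truncn (phi x)^-1) I => /=.
by rewrite ltNge => /negP; apply; rewrite ltW// invf_plt ?posrE// truncnS_gt.
Qed.

(** Domination on open sets passes to closed sets, which are decreasing limits of open ones. Taking
    complements, with both total masses 1, reverses it on open sets, and these form a generating
    pi-system. *)
Lemma probability_eq_open (R : realType) (X : pseudoPMetricType R)
    (P Q : probability (borel X) R) :
  (forall G, open G -> (P G <= Q G)%E) ->
  forall A, measurable A -> P A = Q A.
Proof.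
move=> PQ A mA;
  apply: (@measure_unique _ R (borel X) (@open X) (fun=> setT)) => //.
- by move=> ? ?; exact: openI.
- by move=> _; exact: openT.
- by apply/seteqP; split=> // x _; exists 0%N.
- move=> G oG; apply/eqP; rewrite eq_le PQ//=.
  have [W_ [oW niW WE]] := closed_shrinking (open_closedC oG).
  have mW k : measurable (W_ k : set (borel X)) by exact: measurable_open.
  have mGC : measurable (\bigcap_k W_ k : set (borel X)).
    by rewrite WE; apply: measurableC; exact: measurable_open.
  have cvW (S : probability (borel X) R) : S (W_ k) @[k --> \oo] --> S (~` G).
    by rewrite -WE; apply: nonincreasing_cvg_mu => //;
      rewrite ltey_eq fin_num_measure.
  have : (P (~` G) <= Q (~` G))%E.
    rewrite -(cvg_lim _ (cvW P))// -(cvg_lim _ (cvW Q))//.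
    apply: lee_lim; [by apply/cvg_ex; exists (P (~` G))|
                     by apply/cvg_ex; exists (Q (~` G))|].
    by apply: nearW => k; exact: PQ.
  have mG := measurable_open oG.
  rewrite !probability_setC// => ?.
  have PG : P G \is a fin_num by exact: fin_num_measure.
  have QG : Q G \is a fin_num by exact: fin_num_measure.
  by rewrite -leeN2 -(@leeD2lE _ 1%E).
by move=> _; apply: (@le_lt_trans _ _ 1%E);
  [exact: probability_le1|exact: ltry].
Qed.

Lemma weak_cvg_integral (R : realType) (X : ptopologicalType)
    (eta : nat -> probability (borel X) R) (m : probability (borel X) R) :
  (eta : nat -> Pweak X R) @ \oo --> (m : Pweak X R) ->
  forall f : X -> R, continuous f -> (forall x, 0 <= f x <= 1) ->
    (\int[eta n]_x (f x)%:E)%E @[n --> \oo] --> (\int[m]_x (f x)%:E)%E.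
Proof.
move=> em f cf f01.
have bf : exists M : R, forall x, `|f x| <= M.
  by exists 1 => x; have /andP[? ?] := f01 x; rewrite ger0_norm.
pose F : bcfun X R := exist _ f (conj cf bf).
have cw : {for (m : Pweak X R), continuous (fun P : Pweak X R => weak_map P F)}.
  apply: (@continuous_comp _ _ _ (@weak_map X R : Pweak X R -> _)
    (fun g : {ptws bcfun X R -> \bar R} => g F)).
    exact: initial_continuous.
  exact: (@proj_continuous {classic bcfun X R} (fun=> \bar R) F).
exact: (cvg_comp _ _ em cw).
Qed.

Lemma measurable_fun_gt d (T : measurableType d) (R : realType)
    (f : T -> \bar R) :
  (forall a : R, measurable [set x | (a%:E < f x)%E]) -> measurable_fun setT f.
Proof.
move=> fm; apply: (measurability _ (ErealGenOInfty.measurableE R)).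
by move=> /= _ [_ [a ->]] <-; rewrite setTI preimage_itvoy; exact: fm.
Qed.

Lemma measurable_continuous (R : realType) (X : ptopologicalType)
  (f : X -> R) : continuous f ->
  measurable_fun setT (EFin \o f : borel X -> \bar R).
Proof.
move=> cf; apply: measurable_fun_gt => a; apply: measurable_open.
rewrite (_ : mkset _ = f @^-1` [set t | a < t]).
  by apply: open_comp => //; exact: open_gt.
by apply/seteqP; split=> x; rewrite /= lte_fin.
Qed.

Lemma integral_between (R : realType) (X : ptopologicalType)
    (P : probability (borel X) R) (A B : set X) (f : X -> R) :
  measurable (A : set (borel X)) -> measurable (B : set (borel X)) ->
  continuous f -> (forall x, 0 <= f x <= 1) ->
  (forall x, A x -> f x = 1) -> (forall x, ~ B x -> f x = 0) ->
  (P A <= \int[P]_x (f x)%:E <= P B)%E.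
Proof.
move=> mA mB cf f01 fA fB; have mf := measurable_continuous cf.
have iE (C : set (borel X)) (mC : measurable C) :=
  integral_indic P measurableT mC.
have m1 (C : set (borel X)) : measurable C ->
    measurable_fun setT (fun x => (\1_C x : R)%:E).
  by move=> mC; apply/measurable_EFinP; exact: measurable_indic.
rewrite -[A]setIT -[B]setIT -(iE _ mA) -(iE _ mB).
apply/andP; split; apply: ge0_le_integral => //.
- exact: m1.
- move=> x _; rewrite lee_fin indicE;
  have [/set_mem/fA->//|_] := boolP (x \in A).
  by have /andP[] := f01 x.
- by move=> x _; have /andP[] := f01 x.
- exact: m1.
- move=> x _; rewrite lee_fin indicE; have [_|/negP nB] := boolP (x \in B).
    by have /andP[] := f01 x.
  by rewrite fB// => /mem_set.
Qed.

Lemma polish_balls (R : realType) (X : completePseudoMetricType R) :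
  polish X -> exists B : nat -> nat -> set X,
    [/\ forall k i, open (B k i), forall k, \bigcup_i B k i = setT,
        forall k i, exists y, B k i `<=` ball y k.+1%:R^-1 &
        forall G x, open G -> G x ->
          exists k i, B k i x /\ closure (B k i) `<=` G].
Proof.
move=> [_ [S [cS dS]]].
have [s sS] : exists s : nat -> X, S `<=` range s.
  have /countable_injP[f finj] := cS.
  exists (fun n => get [set x | S x /\ f x = n]) => x Sx; exists (f x) => //.
  have [Sg fg]
    := @getPex _ [set y | S y /\ f y = f x] (ex_intro _ x (conj Sx erefl)).
  by apply: finj fg; exact: mem_set.
pose B k i := (ball (s i) k.+1%:R^-1 : set X)°.
have k0 k : 0 < k.+1%:R^-1 :> R by rewrite invr_gt0.
have Bcov k x : exists i, B k i x.
  (* Halving the radius puts [x] in the interior of the ball, not merely in the ball. *)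
  have e0 : 0 < k.+1%:R^-1 / 2 :> R by rewrite divr_gt0.
  have [] := dS (ball x (k.+1%:R^-1 / 2))°.
  - by exists x; apply: nbhsx_ballx.
  - exact: open_interior.
  move=> y [/interior_subset xy /sS[i _ siy]]; exists i; subst y.
  apply/nbhs_ballP; exists (k.+1%:R^-1 / 2) => // z xz.
  by rewrite [k.+1%:R^-1]splitr; exact: ball_triangle (ball_sym xy) xz.
exists B; split.
- by move=> k i; exact: open_interior.
- by move=> k; apply/seteqP; split=> // x _; have [i Bi] := Bcov k x; exists i.
- by move=> k i; exists (s i); exact: interior_subset.
move=> G x oG Gx;
  have /nbhs_ballP[e/= e0 eG] : nbhs x G by exact: open_nbhs_nbhs.
(* Three radii must fit into [e]: from a point of the closure to some [w] of [B k i], from [w] to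
   the centre [s i], and from there to [x]. *)
pose k := Num.truncn (e / 3)^-1.
have ke : k.+1%:R^-1 <= e / 3.
  by rewrite ltW// invf_plt ?posrE ?divr_gt0// truncnS_gt.
have [i Bi] := Bcov k x; exists k, i; split=> // z.
have /[swap]/[apply] : nbhs z (ball z k.+1%:R^-1) by exact: nbhsx_ballx.
move=> [w [/interior_subset bw zw]]; apply: eG.
have bx := interior_subset Bi.
apply: (@le_ball _ _ _ (k.+1%:R^-1 + k.+1%:R^-1 + k.+1%:R^-1));
  first by move: ke; clear; set t := _^-1; lra.
apply: ball_triangle (ball_sym zw).
by apply: ball_triangle bw; exact: ball_sym.
Qed.

(** The countable basis of [polish_balls] writes [G] as a countable union of open rectangles, so it
    belongs to the product of the Borel sigma-algebras. *)
Lemma measurable_open_prod (R : realType) (X : completePseudoMetricType R)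
    (G : set (X * X)) :
  polish X -> open G -> measurable (G : set (borel X * borel X)).
Proof.
move=> /polish_balls[B [oB _ _ basisB]] oG.
pose J := [set j : (nat * nat) * (nat * nat) |
  B j.1.1 j.1.2 `*` B j.2.1 j.2.2 `<=` G].
rewrite (_ : G = \bigcup_j
    (if j \in J then B j.1.1 j.1.2 `*` B j.2.1 j.2.2 else set0)).
  apply: countable_bigcupT_measurable => // j; case: ifPn => // _.
  by apply: measurableX; exact: measurable_open.
apply/seteqP; split=> z; last first.
  by move=> [j _]; case: ifPn => // /set_mem; exact.
move=> Gz; have : nbhs z G by exact: open_nbhs_nbhs.
move=> [[V W] /= [z1V z2W] VWG].
have [k [i [Bz1 BV]]] := basisB _ _ (open_interior V) z1V.
have [k' [i' [Bz2 BW]]] := basisB _ _ (open_interior W) z2W.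
have jJ : ((k, i), (k', i')) \in J.
  apply/mem_set => -[u v]/= [Bu Bv]; apply: VWG; split.
    by apply: interior_subset; apply: BV; exact: subset_closure.
  by apply: interior_subset; apply: BW; exact: subset_closure.
by exists ((k, i), (k', i')) => //; rewrite jJ.
Qed.

(** * Limits along the ultrafilter of random sequences *)

(** The standard part map of nonstandard analysis, composed with [f]; where there is no limit, [lim]
    returns [point]. *)
Definition stdpart d (Z : measurableType d) (X : ptopologicalType)
  (f : Z -> borel X) (w : internal_algebra Z) : borel X :=
  lim ((f (w n) : X) @[n --> ultra_nat]).

Definition nearstd d (Z : measurableType d) (X : ptopologicalType)
  (f : Z -> borel X) : set (internal_algebra Z) :=
  [set w | cvg ((f (w n) : X) @[n --> ultra_nat])].

Section standard_part.
Context d (Z : measurableType d) (R : realType) (X : completePseudoMetricType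
  R).
Variables (f : Z -> borel X) (pi_ : nat -> probability Z R).
Variables (eta : nat -> probability (borel X) R) (m : probability (borel X) R).
Variable P : probability (internal_algebra Z) R.
Hypotheses (polX : polish X) (mf : measurable_fun setT f).
Hypothesis PE : forall A : nat -> set Z, (forall n, measurable (A n)) ->
  pi_ n (A n) @[n --> ultra_nat] --> P (internal A).
Hypothesis pif : forall n A, measurable A -> pi_ n (f @^-1` A) = eta n A.
Hypothesis etam : (eta : nat -> Pweak X R) @ \oo --> (m : Pweak X R).

Let lifted (G : set X) : set (internal_algebra Z) :=
  internal (fun=> f @^-1` G).

Let mfG (G : set X) : open G -> measurable (f @^-1` G).
Proof. by move=> oG; rewrite -[_ @^-1` _]setTI; apply: mf => //;
  exact: measurable_open. Qed.

Let mlifted (G : set X) : open G -> measurable (lifted G).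
Proof. by move=> oG; apply: measurable_internal => _; exact: mfG. Qed.

Let cvg_lifted (G : set X) : open G -> eta n G @[n --> ultra_nat] --> P
  (lifted G).
Proof.
move=> oG; rewrite (_ : (fun n => eta n G) = fun n => pi_ n (f @^-1` G)).
  exact: (PE (fun=> mfG oG)).
by apply/funext => n; rewrite pif//; exact: measurable_open.
Qed.

(* The function g interpolates between the indicators of G' and G, and its
   integral under eta n converges to its integral under m. *)
Let lifted_between (G' G : set X) (g : X -> R) : open G' -> open G ->
  continuous g -> (forall x, 0 <= g x <= 1) -> (forall x, G' x -> g x = 1) ->
  (forall x, ~ G x -> g x = 0) ->
  (P (lifted G') <= m G)%E /\ (m G' <= P (lifted G))%E.
Proof.
move=> oG' oG cg g01 g1 g0.
have bt (S : probability (borel X) R) := integral_between S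
  (measurable_open oG') (measurable_open oG) cg g01 g1 g0.
have cv := cvg_ultra_nat (weak_cvg_integral etam cg g01).
have cG := cvg_lifted oG; have cG' := cvg_lifted oG'.
have /andP[mG' mG] := bt m; split.
- apply: le_trans mG; rewrite -(cvg_lim _ cG')// -(cvg_lim _ cv)//.
  apply: lee_lim; [exact: cvgP cG'|exact: cvgP cv|].
  by apply: nearW => n; have /andP[] := bt (eta n).
- apply: (le_trans mG'); rewrite -(cvg_lim _ cG)// -(cvg_lim _ cv)//.
  apply: lee_lim; [exact: cvgP cv|exact: cvgP cG|].
  by apply: nearW => n; have /andP[] := bt (eta n).
Qed.

Let le_lifted (G : set X) : open G -> (m G <= P (lifted G))%E.
Proof.
move=> oG; have [G_ [oG_ ndG GE gG]] := open_exhaustion oG.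
have : m (G_ k) @[k --> \oo] --> m G.
  rewrite -GE; apply: nondecreasing_cvg_mu => //.
    by move=> k; exact: measurable_open.
  by rewrite GE; exact: measurable_open.
move=> cv; rewrite -(cvg_lim _ cv)//; apply: lime_le; first exact: cvgP cv.
apply: nearW => k; have [g [cg g01 g1 g0]] := gG k.
by have [] := lifted_between (oG_ k) oG cg g01 g1 g0.
Qed.

(** By completeness, convergence along U means lying U-almost always in a single [B k i] for each
    [k]. Finitely many [B k i] carry [m]-mass close to 1, and [le_lifted] transfers this to [P];
    this plays the role of tightness. *)
Lemma nearstd_ae : measurable (nearstd f) /\ P (~` nearstd f) = 0%E.
Proof.
have [B [oB cB smallB basisB]] := polish_balls polX.
pose E k : set (internal_algebra Z) := \bigcup_i lifted (B k i).
have mE k : measurable (E k).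
  by apply: bigcupT_measurable => i; exact: mlifted.
have nE : nearstd f = \bigcap_k E k.
  apply/seteqP; split=> w.
    move=> /cvg_ex[l fl] k _.
    have [i _ Bl] : (\bigcup_i B k i) l by rewrite cB.
    by exists i => //; apply: fl; exact: open_nbhs_nbhs.
  move=> Ew; apply/cauchy_cvgP/cauchy_exP => e e0.
  have [i _ Bi] := Ew (Num.truncn e^-1) I.
  have [y By] := smallB (Num.truncn e^-1) i.
  exists y; apply: filterS Bi => n /By; apply: le_ball.
  by rewrite ltW// invf_plt ?posrE// truncnS_gt.
split; first by rewrite nE; exact: bigcapT_measurable.
rewrite nE setC_bigcap.
have PE0 k : P (~` E k) = 0%E.
  rewrite probability_setC//; suff -> : P (E k) = 1%E by rewrite subee.
  apply/eqP; rewrite eq_le probability_le1//=.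
  (* [internal] commutes with finite unions but not with countable ones, hence the passage through
     [V N]. *)
  pose V N := \bigcup_(i < N) B k i.
  have oV N : open (V N) by exact: bigcup_open.
  have cvV : m (V N) @[N --> \oo] --> 1%E.
    have VT : \bigcup_N V N = setT.
      apply/seteqP; split=> // x _; have : (\bigcup_i B k i) x by rewrite cB.
      by move=> [i _ Bi]; exists i.+1 => //; exists i => /=.
    rewrite -(probability_setT m) -VT; apply: nondecreasing_cvg_mu.
    - by move=> N; exact: measurable_open.
    - by rewrite VT.
    - move=> M N MN; rewrite subsetEset => x [i /= iM Bi]; exists i => //=.
      exact: leq_trans iM MN.
  rewrite -(cvg_lim _ cvV)//; apply: lime_le; first exact: cvgP cvV.
  apply: nearW => N; apply: le_trans (le_lifted (oV N)) _.
  apply: le_measure; rewrite ?inE//; first exact: mlifted.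
  rewrite /lifted preimage_bigcup (internal_bigcup (fun i _ => f @^-1` B k i)).
  by move=> w [i _ Bi]; exists i.
apply/eqP; rewrite eq_le measure_ge0 andbT.
have UcE : measurable (\bigcup_k ~` E k).
  by apply: bigcupT_measurable => k; exact: measurableC.
apply: le_trans (le_mu_bigcup _ _ UcE) _; first by move=> k; exact: measurableC.
by rewrite eseries0// => k _ _; exact: PE0.
Qed.

(** A limit lies in an open [G] exactly when the sequence is U-almost always in some basic set with
    closure in [G]; the closure is needed because limits may leave the basic set. Divergent
    sequences all go to [point]. *)
Lemma measurable_stdpart : measurable_fun setT (stdpart f).
Proof.
have [B [oB cB smallB basisB]] := polish_balls polX.
have [mN _] := nearstd_ae.
apply: (@measurability _ _ (internal_algebra Z) (borel X) setT (stdpart f)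
  (@open X) erefl) => _ [G oG <-]; rewrite setTI.
pose J := [set j : nat * nat | closure (B j.1 j.2) `<=` G].
rewrite (_ : _ @^-1` _ = (nearstd f `&`
    \bigcup_j (if j \in J then lifted (B j.1 j.2) else set0)) `|`
    (~` nearstd f `&` [set _ | G point])).
  apply: measurableU; apply: measurableI => //.
  - apply: countable_bigcupT_measurable => // j; case: ifPn => // _.
    exact: mlifted.
  - exact: measurableC.
  - have [Gp|nGp] := pselect (G point).
      by rewrite (_ : [set _ | _] = setT)//; apply/seteqP; split.
    by rewrite (_ : [set _ | _] = set0)//; apply/seteqP; split.
apply/seteqP; split=> w /=.
  rewrite /stdpart => Gl; have [Nw|nNw] := pselect (nearstd f w); last first.
    by right; split=> //; move: Gl; rewrite dvgP.
  left; split=> //; have [k [i [Bl BG]]] := basisB _ _ oG Gl.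
  exists (k, i) => //; rewrite ifT; last exact/mem_set.
  by apply: (Nw); exact: open_nbhs_nbhs.
move=> [[Nw [j _]]|[nNw]]; last by rewrite /stdpart dvgP.
case: ifPn => // /set_mem JG Bw; apply: JG => A lA.
have [n [Bn An]] := ultra_nat_meets Bw (Nw _ lA).
by exists (f (w n)).
Qed.

Lemma stdpart_open (G : set X) : open G ->
  stdpart f @^-1` G `<=` ~` nearstd f `|` lifted G.
Proof.
move=> oG w Gw; have [Nw|nNw] := pselect (nearstd f w); last by left.
by right; apply: (Nw); exact: open_nbhs_nbhs.
Qed.

(** By [probability_eq_open] an upper bound on open sets is enough. It is proved for [G_ k] and then
    passed to the limit, since [lifted_between] compares a lifted open set only with a larger
    one. *)
Lemma stdpart_law (A : set (borel X)) :
  measurable A -> P (stdpart f @^-1` A) = m A.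
Proof.
have [mN N0] := nearstd_ae.
pose S : {mfun internal_algebra Z >-> borel X} := HB.pack (stdpart f)
  (isMeasurableFun.Build _ _ _ _ (stdpart f) measurable_stdpart).
pose Q : probability (borel X) R := distribution P S.
move: A; apply: (@probability_eq_open _ _ Q) => G oG.
have [G_ [oG_ ndG GE gG]] := open_exhaustion oG.
have : Q (G_ k) @[k --> \oo] --> Q G.
  rewrite -GE; apply: nondecreasing_cvg_mu => //.
    by move=> k; exact: measurable_open.
  by rewrite GE; exact: measurable_open.
move=> cv; rewrite -(cvg_lim _ cv)//; apply: lime_le; first exact: cvgP cv.
apply: nearW => k; have [g [cg g01 g1 g0]] := gG k.
have [] := lifted_between (oG_ k) oG cg g01 g1 g0 => + _.
move=> Pm; apply: le_trans Pm.
have mNC := measurableC mN.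
have mGk : measurable (stdpart f @^-1` G_ k).
  by rewrite -[_ @^-1` _]setTI; apply: measurable_stdpart => //;
    exact: measurable_open.
apply: (@le_trans _ _ (P (~` nearstd f `|` lifted (G_ k)))).
  change (P (stdpart f @^-1` G_ k) <= P (~` nearstd f `|` lifted (G_ k)))%E.
  apply: le_measure; rewrite ?inE//; last exact: stdpart_open.
  by apply: measurableU => //; exact: mlifted.
apply: (@le_trans _ _ (P (~` nearstd f) + P (lifted (G_ k)))%E).
  exact: measureU2 mNC (mlifted (oG_ k)).
by rewrite N0 add0e.
Qed.

End standard_part.

(** * Integrals of lower semicontinuous costs *)

(** A discrete layer-cake sum: its integral sees the cost only through the masses of strict
    superlevel sets, which are open for a lower semicontinuous cost. *)
Definition staircase (R : realType) (e : R) (N : nat) (x : \bar R) : R :=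
  \sum_(j < N) e * ((j.+1%:R * e)%:E < x)%E%:R.

Lemma staircase_le (R : realType) (e : R) N (x : \bar R) :
  0 < e -> (0 <= x)%E -> ((staircase e N x)%:E <= x)%E.
Proof.
move=> e0 x0; case: x x0 => [r||//]; last by move=> _; exact: leey.
rewrite !lee_fin => r0.
(* The second bound feeds the induction: if level [(N + 1) * e] is below [r], adding [e] to a sum of
   at most [N * e] stays below [r]. *)
suff /andP[] : (staircase e N r%:E <= r) && (staircase e N r%:E <= N%:R * e)
  by [].
elim: N => [|N /andP[IHr IHN]];
  first by rewrite /staircase big_ord0 r0 mul0r lexx.
rewrite /staircase big_ord_recr/= -/(staircase e N r%:E) lte_fin.
rewrite -natr1 mulrDl mul1r; move: IHr IHN; set t := N%:R * e => IHr IHN.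
by case: ltP => jr; rewrite /= ?mulr1 ?mulr0; apply/andP; split; lra.
Qed.

(** Apart from truncation in height, at most one step [e] is lost. The real [b] stands in for [x],
    which may be infinite. *)
Lemma staircase_ge (R : realType) (e : R) N (b : R) (x : \bar R) :
  0 < e -> (b%:E <= x)%E -> Num.min b (N.+1%:R * e) - e <= staircase e N x.
Proof.
move=> e0 bx; elim: N => [|N IH].
  by rewrite /staircase big_ord0 mul1r subr_le0 ge_min lexx orbT.
rewrite /staircase big_ord_recr/= -/(staircase e N x).
have [jx|xj] := ltP; rewrite /= ?mulr1 ?mulr0 ?addr0.
  have -> : N.+2%:R * e = N.+1%:R * e + e by rewrite -natr1 mulrDl mul1r.
  move: IH; set t := N.+1%:R * e; rewrite /Num.min; case: ltP => ?;
    case: ltP => ? ?; lra.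
have bN : b <= N.+1%:R * e by rewrite -lee_fin; exact: le_trans xj.
apply: le_trans IH; have /min_idPl -> := bN.
by rewrite lerD2r ge_min lexx.
Qed.

Lemma staircase_ge0 (R : realType) (e : R) N (x : \bar R) :
  0 <= e -> 0 <= staircase e N x.
Proof. by move=> e0; apply: sumr_ge0 => j _; rewrite mulr_ge0. Qed.

(** With mesh [1 / (k + 1)], taking [(k + 1) ^ 2] levels reaches height [k + 1], so the mesh
    vanishes while the height grows to infinity. *)
Lemma cvg_staircase (R : realType) (x : \bar R) : (0 <= x)%E ->
  (staircase k.+1%:R^-1 (k.+1 ^ 2) x)%:E @[k --> \oo] --> x.
Proof.
move=> x0.
have e0 k : 0 < k.+1%:R^-1 :> R by rewrite invr_gt0.
have kk k : (k.+1 ^ 2)%:R * k.+1%:R^-1 = k.+1%:R :> R.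
  by rewrite natrX expr2 mulfK.
have kk1 k : k.+1%:R <= (k.+1 ^ 2).+1%:R * k.+1%:R^-1 :> R.
  by rewrite -[(k.+1 ^ 2).+1%:R]natr1 mulrDl kk lerDl mul1r invr_ge0.
case: x x0 => [r||//].
  rewrite lee_fin => r0; apply: cvg_EFin; first exact: nearW.
  apply: (@squeeze_cvgr _ _ _ _ (fun k => r - k.+1%:R^-1) (fun=> r)).
  - near=> k => /=; apply/andP; split; last first.
      by rewrite -lee_fin; exact: staircase_le.
    apply: le_trans (staircase_ge _ (e0 k) (lexx r%:E)).
    rewrite lerB// le_min lexx/=; apply: le_trans (kk1 k).
    near: k; exists (Num.truncn r) => // k /= rk.
    apply/ltW/(lt_le_trans (truncnS_gt r)); by rewrite ler_nat.
  - rewrite -[X in _ --> X]subr0; apply: cvgB; first exact: cvg_cst.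
    exact: cvg_harmonic.
  - exact: cvg_cst.
move=> _; apply/cvgeyPge => A; near=> k.
have := staircase_ge (k.+1 ^ 2) (e0 k) (leey ((k.+1 ^ 2).+1%:R / k.+1%:R)%:E).
rewrite minxx -[(k.+1 ^ 2).+1%:R]natr1 mulrDl kk mul1r addrK lee_fin;
  apply: le_trans.
near: k; exists (Num.truncn A) => // k /= Ak.
by apply/ltW/(lt_le_trans (truncnS_gt A)); rewrite ler_nat.
Unshelve. all: by end_near. Qed.

Section staircase_integral.
Context d (T : measurableType d) (R : realType) (c : T -> \bar R).
Hypotheses (mc : forall a : R, measurable [set z | (a%:E < c z)%E])
  (c0 : forall z, (0 <= c z)%E).

Lemma measurable_staircase (e : R) N :
  measurable_fun setT (fun z => (staircase e N (c z))%:E).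
Proof.
apply/measurable_EFinP; apply: measurable_sum => j.
apply: measurable_funM; first exact: measurable_cst.
rewrite (_ : (fun _ => _) = (\1_[set z | ((j.+1%:R * e)%:E < c z)%E] : T -> R)).
  exact: measurable_indic.
by apply/funext => z; rewrite indicE; congr ((nat_of_bool _)%:R);
  apply/idP/idP => [?|/set_mem//]; exact/mem_set.
Qed.

Lemma integral_staircase (P : probability T R) (e : R) N : 0 < e ->
  (\int[P]_z (staircase e N (c z))%:E =
   \sum_(j < N) e%:E * P [set z | ((j.+1%:R * e)%:E < c z)%E])%E.
Proof.
move=> e0; pose A j := [set z | ((j.+1%:R * e)%:E < c z)%E].
rewrite (eq_integral (fun z => \sum_(j < N) e%:E * (\1_(A j) z)%:E)%E);
  last first.
  move=> z _; rewrite /staircase -sumEFin; apply: eq_bigr => j _.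
  rewrite EFinM indicE; congr (_ * ((nat_of_bool _)%:R)%:E)%E.
  by apply/esym; apply/idP/idP => [/set_mem//|?]; exact/mem_set.
have mA j : measurable_fun setT (fun z => (\1_(A j) z : R)%:E).
  by apply/measurable_EFinP; apply: measurable_indic; exact: mc.
rewrite ge0_integral_sum//.
- apply: eq_bigr => j _; rewrite ge0_integralZl//; last by rewrite lee_fin ltW.
  by rewrite integral_indic ?setIT//; exact: mc.
- by move=> j; apply: measurable_funeM; exact: mA.
- by move=> j z _; rewrite mule_ge0// lee_fin// ltW.
Qed.

(** The approximations [s k] need not be monotone in [k], so the limit is taken with Fatou's
    lemma. *)
Lemma le_integral_staircase (P : probability T R) (a : \bar R) :
  (forall (e : R) N, 0 < e ->
    (\sum_(j < N) e%:E * P [set z | ((j.+1%:R * e)%:E < c z)%E] <= a)%E) ->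
  (\int[P]_z c z <= a)%E.
Proof.
move=> Pa; pose s k z := (staircase k.+1%:R^-1 (k.+1 ^ 2) (c z))%:E : \bar R.
have e0 k : 0 < k.+1%:R^-1 :> R by rewrite invr_gt0.
have sc z : limn_einf (s^~ z) = c z.
  by rewrite (cvg_limn_einf_sup (cvg_staircase (c0 z))).
under eq_integral do rewrite -sc.
apply: le_trans (fatou _ _ _ _) _ => //.
- by move=> k; exact: measurable_staircase.
- by move=> k z _; rewrite lee_fin staircase_ge0// ltW.
rewrite limn_einf_lim; apply: lime_le; first exact: is_cvg_einfs.
apply: nearW => k; apply: (@le_trans _ _ (\int[P]_z s k z)%E).
  by apply: ereal_inf_lbound; exists k => /=.
by rewrite integral_staircase//; exact: Pa.
Qed.

Lemma staircase_le_integral (P : probability T R) (e : R) N : 0 < e ->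
  (\sum_(j < N) e%:E * P [set z | ((j.+1%:R * e)%:E < c z)%E] <=
   \int[P]_z c z)%E.
Proof.
move=> e0; rewrite -integral_staircase//; apply: ge0_le_integral => //.
- by move=> z _; rewrite lee_fin staircase_ge0// ltW.
- exact: measurable_staircase.
- exact: measurable_fun_gt.
- by move=> z _; exact: staircase_le.
Qed.

End staircase_integral.

(** * Limits of couplings and the optimal transport cost *)

Lemma coupling_ultralimit (R : realType) (X : completePseudoMetricType R)
    (eta : nat -> probability (borel X) R) (mu nu : probability (borel X) R)
    (pi_ : nat -> probability (borel X * borel X)%type R) :
  polish X -> (eta : nat -> Pweak X R) @ \oo --> (mu : Pweak X R) ->
  (forall n, is_coupling (eta n) nu (pi_ n)) ->
  exists2 pi, is_coupling mu nu pi & forall G : set (X * X), open G ->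
    exists2 l, pi_ n G @[n --> ultra_nat] --> l & (pi G <= l)%E.
Proof.
move=> polX etamu cpl; have [P PE] := loeb_probability pi_.
pose Z := (borel X * borel X)%type.
have m1 : measurable_fun setT (fst : Z -> borel X) by exact: measurable_fst.
have m2 : measurable_fun setT (snd : Z -> borel X) by exact: measurable_snd.
have pi1 n (A : set (borel X)) : measurable A ->
    pi_ n ((fst : Z -> borel X) @^-1` A) = eta n A.
  move=> mA; rewrite -(cpl n).1//; congr (pi_ n _).
  by apply/seteqP; split=> z //= [].
have pi2 n (A : set (borel X)) : measurable A ->
    pi_ n ((snd : Z -> borel X) @^-1` A) = nu A.
  move=> mA; rewrite -(cpl n).2//; congr (pi_ n _).
  by apply/seteqP; split=> z //= [].
(* The second marginal is treated as a constant, hence weakly convergent, sequence. *)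
have nunu : ((fun=> nu) : nat -> Pweak X R) @ \oo --> (nu : Pweak X R).
  exact: cvg_cst.
have [mN1 N1] := nearstd_ae polX m1 PE pi1 etamu.
have [mN2 N2] := nearstd_ae polX m2 PE pi2 nunu.
have mT1 := measurable_stdpart polX m1 PE pi1 etamu.
have mT2 := measurable_stdpart polX m2 PE pi2 nunu.
pose T w : Z
  := (stdpart (fst : Z -> borel X) w, stdpart (snd : Z -> borel X) w).
have mT : measurable_fun setT T by exact: measurable_fun_pair.
pose S : {mfun internal_algebra Z >-> Z} := HB.pack T
  (isMeasurableFun.Build _ _ _ _ T mT).
exists (distribution P S).
  split=> A mA; [rewrite -(stdpart_law polX m1 PE pi1 etamu mA)|
                 rewrite -(stdpart_law polX m2 PE pi2 nunu mA)];
    by congr (P _); apply/seteqP; split=> w //= [].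
move=> G oG; have mG := measurable_open_prod polX oG.
exists (P (internal (fun=> (G : set Z)))); first by apply: (PE (fun=> G)).
pose N1c := ~` nearstd (fst : Z -> borel X).
pose N2c := ~` nearstd (snd : Z -> borel X).
have mI : measurable (internal (fun=> (G : set Z)) : set (internal_algebra Z)).
  exact: measurable_internal.
have mN1c : measurable N1c by exact: measurableC.
have mN2c : measurable N2c by exact: measurableC.
(* Where both coordinates converge and the limit pair lies in the open set [G], the pairs [w n] lie
   in [G] for U-almost all [n]; the two exceptional sets are null. *)
apply: (@le_trans _ _ (P (N1c `|` (N2c `|` internal (fun=> (G : set Z)))))).
  change (P (T @^-1` G) <=
    P (N1c `|` (N2c `|` internal (fun=> (G : set Z)))))%E.
  apply: le_measure; rewrite ?inE.
  - by rewrite -[_ @^-1` _]setTI; exact (mT measurableT _ mG).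
  - by do 2 (apply: measurableU => //).
  move=> w Gw; have [c1|?] := pselect (nearstd (fst : Z -> borel X) w);
    last by left.
  have [c2|?] := pselect (nearstd (snd : Z -> borel X) w); last by right; left.
  right; right; have : nbhs (T w : X * X) G by exact: open_nbhs_nbhs.
  move=> [[V W] /= [/c1 UV /c2 UW] VWG].
  have {}UV : ultra_nat [set n | V (w n).1] by exact: UV.
  have {}UW : ultra_nat [set n | W (w n).2] by exact: UW.
  by apply: filterS2 UV UW => n Vn Wn; apply: VWG.
have mU := measurableU _ _ mN2c mI.
apply: (@le_trans _ _ (P N1c + P (N2c `|` internal (fun=> (G : set Z))))%E).
  exact: measureU2 mN1c mU.
rewrite N1 add0e.
apply: (@le_trans _ _ (P N2c + P (internal (fun=> (G : set Z))))%E).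
  exact: measureU2 mN2c mI.
by rewrite N2 add0e.
Qed.

Lemma measurable_cost_gt (R : realType) (X : completePseudoMetricType R)
    (c : X * X -> \bar R) (a : R) : polish X -> lower_semicontinuous c ->
  measurable ([set z | (a%:E < c z)%E] : set (borel X * borel X)).
Proof.
move=> polX /lower_semicontinuousP lc.
by apply: measurable_open_prod => //; exact: lc.
Qed.

(** Superlevel sets of [c] are open, so each finite staircase sum of the limit coupling is at most
    the U-limit of those of [pi_ n], and these stay below the integral of [c], hence below [a]. *)
Lemma OTcost_closed (R : realType) (X : completePseudoMetricType R)
    (c : X * X -> \bar R) (eta : nat -> probability (borel X) R)
    (mu nu : probability (borel X) R) (a : \bar R) :
  polish X -> cost_function c ->
  (eta : nat -> Pweak X R) @ \oo --> (mu : Pweak X R) ->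
  (forall n, (OTcost c (eta n) nu < a)%E) -> (OTcost c mu nu <= a)%E.
Proof.
move=> polX [c0 lc] etamu OTa.
have /choice[pi_ pi_P] : forall n, exists pi : probability _ R,
    is_coupling (eta n) nu pi /\ (\int[pi]_z c z <= a)%E.
  move=> n; have /ereal_inf_lt[_ [pi cpi <-]] := OTa n.
  by move=> /ltW; exists pi.
have [pi cpi piG] := coupling_ultralimit polX etamu (fun n => (pi_P n).1).
apply: (@le_trans _ _ (\int[pi]_z c z)%E).
  by apply: ereal_inf_lbound; exists pi.
have mc b := measurable_cost_gt b polX lc.
apply: (@le_integral_staircase _ (borel X * borel X)%type R c mc c0) => e N e0.
have /choice[l lP] : forall j : nat, exists l : \bar R,
    pi_ n [set z | ((j.+1%:R * e)%:E < c z)%E] @[n --> ultra_nat] --> l /\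
    (pi [set z | ((j.+1%:R * e)%:E < c z)%E] <= l)%E.
  move=> j; have [|l] := piG [set z | ((j.+1%:R * e)%:E < c z)%E].
    by move/lower_semicontinuousP : lc; exact.
  by exists l.
apply: (@le_trans _ _ (\sum_(j < N) e%:E * l j)%E).
  by apply: lee_sum => j _; rewrite lee_wpmul2l ?lee_fin ?(ltW e0)// (lP j).2.
have cv : (\sum_(j < N) e%:E * pi_ n [set z | ((j.+1%:R * e)%:E < c z)%E])%E
    @[n --> ultra_nat] --> (\sum_(j < N) e%:E * l j)%E.
  apply: cvg_nnesum => j _.
    by apply: nearW => n; rewrite mule_ge0// lee_fin ltW.
  by apply: cvgeZl => //; exact: (lP j).1.
rewrite -(cvg_lim _ cv)//; apply: lime_le; first exact: cvgP cv.
apply: nearW => n; apply: le_trans (pi_P n).2.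
exact: (@staircase_le_integral _ (borel X * borel X)%type R c mc c0).
Qed.

(** * Scaling of the cost and the limit as [r] tends to [0+] *)

Lemma OTcostZ (R : realType) (X : completePseudoMetricType R)
    (c : X * X -> \bar R) (r : R) (mu nu : probability (borel X) R) :
  polish X -> cost_function c -> 0 < r ->
  OTcost (fun z => (r%:E * c z)%E) mu nu = (r%:E * OTcost c mu nu)%E.
Proof.
move=> polX [c0 lc] r0; rewrite /OTcost -ereal_inf_pZl// image_comp.
congr ereal_inf; apply: eq_imagel => pi _ /=.
rewrite ge0_integralZl//; last by rewrite lee_fin ltW.
by apply: measurable_fun_gt => a; exact: measurable_cost_gt.
Qed.

Lemma OTcost_ge0 (R : realType) (X : completePseudoMetricType R)
    (c : X * X -> \bar R) (mu nu : probability (borel X) R) :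
  (forall z, (0 <= c z)%E) -> (0 <= OTcost c mu nu)%E.
Proof.
by move=> c0; apply: le_ereal_inf_tmp => _ [pi _ <-]; exact: integral_ge0.
Qed.

(** Testing against real [a] below [C] lets one argument serve finite and infinite transport costs
    alike. *)
Lemma cvg_ereal_sup (R : realType) (I : Type) (F : set_system I)
    (FF : Filter F) (g : I -> \bar R) (C : \bar R) :
  (0 <= C)%E -> (\forall r \near F, (g r <= C)%E) ->
  (forall a : R, (a%:E < C)%E -> \forall r \near F, (a%:E <= g r)%E) ->
  g @ F --> C.
Proof.
case: C => [C _ gC Cg|_ _ Cg|//]; last first.
  by apply/cvgeyPge => A; apply: Cg; exact: ltry.
have lb e : 0 < e -> \forall r \near F, ((C - e)%:E <= g r)%E.
  by move=> e0; apply: Cg; rewrite lte_fin ltrBlDr ltrDl.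
have gfin : \forall r \near F, g r \is a fin_num.
  move: (lb 1 ltr01) gC; apply: filterS2 => r; case: (g r) => //.
apply: cvg_EFin => //; apply/cvgrPdist_le => e e0.
move: (lb e e0) gfin gC; apply: filterS3 => r + fg;
  rewrite -(fineK fg) !lee_fin.
by move=> Ce gC /=; rewrite ger0_norm ?subr_ge0// lerBlDl -lerBlDr.
Qed.

Unset Implicit Arguments.

Theorem theorem4 (R : realType) (X : completePseudoMetricType R)
  (D : probability (borel X) R -> probability (borel X) R -> \bar R)
  (c : X * X -> \bar R) (mu : probability (borel X) R) :
  polish X -> pre_divergence D -> cost_function c ->
  lower_semicontinuous (fun P : Pweak X R => D P mu) ->
  (forall a : R, compact [set P : Pweak X R | (D P mu <= a%:E)%E]) ->
  (forall mu_ : nat -> probability (borel X) R,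
      D (mu_ n) mu @[n --> \oo] --> 0%E ->
      (mu_ : nat -> Pweak X R) @ \oo --> (mu : Pweak X R)) ->
  forall nu : probability (borel X) R,
    (fun r : R => ((r^-1)%:E * Dcost D (fun z => (r%:E * c z)%E) nu mu)%E)
      @ 0^'+ --> OTcost c mu nu.
Proof.
move=> polX [D0 Dmu] costc _ _ Dweak nu.
have c0 := costc.1.
apply: cvg_ereal_sup => [||a aC]; first exact: OTcost_ge0.
  near=> r; have r0 : 0 < r by [].
  rewrite lee_pdivrMl//; apply: ereal_inf_lbound; exists mu => //.
  by rewrite Dmu add0e OTcostZ.
apply: contrapT => Hn.
(* Failure of the bound [a] arbitrarily close to [0+] provides a bad [r] below each
   [1 / (n + 1)]. *)
have /choice[r_ r_P] : forall n : nat, exists r : R,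
    [/\ 0 < r, r < n.+1%:R^-1 &
     ((r^-1)%:E * Dcost D (fun z => (r%:E * c z)%E) nu mu < a%:E)%E].
  move=> n; apply: contrapT => nex; apply: Hn.
  near=> r; rewrite leNgt; apply/negP => ra; apply: nex; exists r.
  by split=> //; near: r; apply: nbhs_right_lt; rewrite invr_gt0.
have /choice[eta etaP] : forall n, exists eta : probability (borel X) R,
    (D eta mu + (r_ n)%:E * OTcost c eta nu < (r_ n * a)%:E)%E.
  move=> n; have [r0 rn] := r_P n.
  rewrite muleC lte_pdivrMr// => /ereal_inf_lt[_ [eta _ <-]].
  by rewrite OTcostZ// mulrC; exists eta.
have OTeta n : (OTcost c (eta n) nu < a%:E)%E.
  have [r0 _ _] := r_P n.
  rewrite -(@lte_pmul2l _ (r_ n)%:E)// -EFinM; apply: le_lt_trans (etaP n).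
  by rewrite leeDr.
(* Positivity of [a] lets [r_ n * a] be bounded by [a / (n + 1)] in the squeeze that forces
   [D (eta n) mu] to 0. *)
have a0 : 0 < a.
  by rewrite -lte_fin; apply: le_lt_trans (OTeta 0%N); exact: OTcost_ge0.
have Deta : D (eta n) mu @[n --> \oo] --> 0%E.
  apply: (@squeeze_cvge _ _ _ _ (fun=> 0%E) _ (fun n => (n.+1%:R^-1 * a)%:E)).
  - apply: nearW => n; rewrite D0/=; have [r0 rn _] := r_P n.
    apply: (@le_trans _ _ (r_ n * a)%:E);
      last by rewrite lee_fin ler_pM2r// ltW.
    apply: le_trans (ltW (etaP n)); rewrite leeDl// mule_ge0 ?OTcost_ge0//.
    by rewrite lee_fin ltW.
  - exact: cvg_cst.
  - apply: cvg_EFin; first exact: nearW.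
    rewrite -[X in _ --> X](mul0r a); apply: cvgMl; exact: cvg_harmonic.
have := OTcost_closed polX costc (Dweak _ Deta) OTeta.
by rewrite leNgt aC.
Unshelve. all: by end_near. Qed.
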